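(* Let $k\in\mathbb{N}$. Then $$|\mathcal{J}_{k,n}| = \begin{cases}0, &\text{if } 1\le n\le 3k-3;\\ 1, &\text{if } n = 3k-2;\\ k+1, &\text{if } n = 3k-1;\\ \binom{k+1}{2}+2k+1, &\text{if } n = 3k;\\ \binom{k+1}{3}+2\binom{k+1}{2}+(k+1)^2, &\text{if } n = 3k+1.\end{cases}$$ Moreover, the sequence $(|\mathcal{J}_{k,n}|)_{n=1}^\infty$ satisfies the polynomial $p_k(x) = (x-1)^{2k+1}(x+1)^k$.
   Context: $\mathbb{N}=\{1,2,3,\ldots\}$. A finite nonempty set $F\subset\mathbb{N}$ is Schreier if $\min F\ge |F|$. An interval of integers is a nonempty set consisting of consecutive integers (singletons included). Two intervals $I_1,I_2$ are separated if either $\max I_1+1<\min I_2$ or $\max I_2+1<\min I_1$ (i.e. their union is not an interval). $\mathcal{J}_k$ is the collection of sets that are the union of exactly $k$ (pairwise) separated intervals. For $k,n\in\mathbb{N}$, $$\mathcal{J}_{k,n} := \{F\subset\{1,2,\ldots,n\} : F\text{ is Schreier and }F\in\mathcal{J}_k\}.$$ Let $p(x)=c_rx^r+c_{r-1}x^{r-1}+\cdots+c_1x+c_0$ be a polynomial with real coefficients. A sequence $(a_n)_{n=1}^\infty$ is said to satisfy $p(x)$ if $c_ra_n+c_{r-1}a_{n-1}+\cdots+c_1a_{n-r+1}+c_0a_{n-r}=0$ for all $n\ge r+1$. (Here, for $p_k$, the degree is $r=3k+1$.) *)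

(* Defs.v *)
From mathcomp Require Import all_boot all_order all_algebra finmap.
From mathcomp Require Import boolp reals.

Set Implicit Arguments.
Unset Strict Implicit.
Unset Printing Implicit Defensive.

Import GRing.Theory.

Local Open Scope fset_scope.
Local Open Scope nat_scope.

(* [set_min] and [set_max] are meaningful for nonempty sets only; both return
   0 on [fset0]. *)
Definition set_max (F : {fset nat}) : nat := \max_(i <- F) i.

Definition set_min (F : {fset nat}) : nat := \big[minn/set_max F]_(i <- F) i.

Definition schreier (F : {fset nat}) : Prop :=
  F <> fset0 /\ set_min F >= #|` F|.

(* [{a, ..., b}]; it is empty when [b < a]. *)
Definition int_range (a b : nat) : {fset nat} :=
  [fset i in index_iota a b.+1].

Definition is_interval (I : {fset nat}) : Prop :=
  exists a b : nat, a <= b /\ I = int_range a b.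

Definition separated (I1 I2 : {fset nat}) : Prop :=
  set_max I1 + 1 < set_min I2 \/ set_max I2 + 1 < set_min I1.

Definition union_of_intervals (k : nat) (F : {fset nat}) : Prop :=
  exists I : 'I_k -> {fset nat},
    [/\ forall i, is_interval (I i),
        forall i j, i <> j -> separated (I i) (I j)
      & F = (\bigcup_(i in 'I_k) I i)%fset].

Definition Jkn (k n : nat) : {fset {fset nat}} :=
  [fset F in fpowerset (int_range 1 n) |
     `[< schreier F /\ union_of_intervals k F >]].

(* With [r] the degree of [p], the term at index [i] pairs the coefficient
   [c_i] with [a_(n - r + i)]. The sequence is [a 1, a 2, ...]: [r < n] makes
   the subtraction exact and keeps [a 0] out of every relation. *)
Definition satisfies (R : realType) (a : nat -> R) (p : {poly R}) : Prop :=
  let r := (size p).-1 in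
  forall n : nat, r < n ->
    (\sum_(i < r.+1) p`_i * a (n - r + i)%N = 0)%R.

(* Main.v *)
Require Import Defs.
From mathcomp Require Import all_boot all_order all_algebra finmap.
From mathcomp Require Import boolp reals.
From mathcomp Require Import zify ring.

(** The counts for [k] runs and those for [k - 1] runs are tied by one linear
recurrence, obtained by removing the largest element of a set. Write [a_k n]
for the number of sets to be counted.

A set [F] splits uniquely into maximal runs of consecutive integers, and a run
is determined by its right end, an element [x] of [F] with [x + 1] outside [F].
So being a union of exactly [k] separated intervals means having exactly [k]
right ends ([card_right_ends], [union_of_right_ends]), a condition that is
local and easy to follow when elements are added.

Let [b_k n] count only the sets that contain [n], so that
[a_k (n + 1) = a_k n + b_k (n + 1)]. If a Schreier set [G] has maximum [n + 2],
remove this maximum and translate the rest by [-1]: both the size and the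
minimum drop by one (unless [G] is a singleton, which becomes the empty set),
so the Schreier inequality is preserved, in both directions. The result is a
subset [F] of [{1, ..., n}]. If [n] is in [F], then [n + 2] only lengthened the
last run and [F] still has [k] runs; otherwise [n + 2] was a run of its own and
[F] is a subset of [{1, ..., n - 1}] with [k - 1] runs. Hence
[b_k (n + 2) = b_k n + a_(k-1) (n - 1)] ([card_runs_with_maxSS]), and
eliminating [b_k] gives, for the shift operator [E],

  [(E - 1)^2 (E + 1) a_k = a_(k-1)]      ([card_runs_rec]).

The empty set is admitted as the only set with [0] runs, so that [a_0] is
constantly [1] and is killed by [E - 1]. By induction on [k], the sequence
[a_k] is killed by [(E - 1)^(2k+1) (E + 1)^k], which is the second claim
([shift_act_char]). The first claim is read off the same recurrence by
induction on [k], using Pascal's rule ([card_runs_small],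
[card_runs_init]). *)

Set Implicit Arguments.
Unset Strict Implicit.
Unset Printing Implicit Defensive.

Import GRing.Theory.

Local Open Scope fset_scope.
Local Open Scope nat_scope.

(** * Runs of consecutive integers *)

Definition right_ends (F : {fset nat}) : {fset nat} :=
  [fset x in F | x.+1 \notin F].

Lemma in_int_range a b x : (x \in int_range a b) = (a <= x <= b).
Proof. by rewrite /int_range !inE mem_index_iota ltnS. Qed.

Lemma in_right_ends F x : (x \in right_ends F) = (x \in F) && (x.+1 \notin F).
Proof. by rewrite !inE. Qed.

Lemma set_maxP (F : {fset nat}) m :
  m \in F -> (forall x, x \in F -> x <= m) -> set_max F = m.
Proof.
move=> mF ub; apply/eqP; rewrite eqn_leq /set_max; apply/andP; split.
  by apply/bigmax_leqP_seq => x xF _; apply: ub.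
exact: (@leq_bigmax_seq _ _ xpredT id).
Qed.

(** Taking [m] to be the size of [F] turns the Schreier condition into a bound
on each element, which also makes sense for the empty set. *)
Lemma leq_set_min (F : {fset nat}) m :
  F != fset0 -> (m <= set_min F) <-> (forall x, x \in F -> m <= x).
Proof.
move=> F0; have -> : set_min F = \big[minn/set_max F]_(i <- F) i by [].
have bigminP (M : nat) (s : seq nat) :
    (m <= \big[minn/M]_(i <- s) i) = (m <= M) && all (leq m) s.
  elim: s => [|x s IH]; first by rewrite big_nil andbT.
  by rewrite big_cons leq_min IH /= andbCA.
rewrite bigminP; split=> [/andP [_ /allP mF] x /mF //|mF].
apply/andP; split; last by apply/allP => x /mF.
have [y yF] := fset0Pn _ F0.
exact: leq_trans (mF y yF) (@leq_bigmax_seq _ _ xpredT id y yF isT).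
Qed.

Lemma set_max_int_range a b : a <= b -> set_max (int_range a b) = b.
Proof.
move=> ab; apply: set_maxP; first by rewrite in_int_range ab /=.
by move=> x; rewrite in_int_range => /andP [].
Qed.

Lemma set_min_int_range a b : a <= b -> set_min (int_range a b) = a.
Proof.
move=> ab; have aI : a \in int_range a b by rewrite in_int_range leqnn.
have I0 : int_range a b != fset0 by apply/fset0Pn; exists a.
apply/eqP; rewrite eqn_leq; apply/andP; split.
  by apply: (leq_set_min _ I0).1 aI.
by apply/(leq_set_min _ I0) => x; rewrite in_int_range => /andP [].
Qed.

(** Since the intervals are separated, nothing in the union follows immediately
the right end of one of them; so the right ends of the union are those of the
intervals, and distinct intervals have distinct ones. *)
Lemma card_right_ends k F : union_of_intervals k F -> #|` right_ends F| = k.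
Proof.
move=> [I [Iint Isep FE]].
have [a /choice [b abI]] := choice Iint.
have sep i j : i <> j -> b i + 1 < a j \/ b j + 1 < a i.
  move=> /Isep; have [[abi ->] [abj ->]] := (abI i, abI j).
  by rewrite /separated !set_max_int_range ?set_min_int_range.
have inF x : reflect (exists i, a i <= x <= b i) (x \in F).
  rewrite FE; apply: (iffP (bigfcupP _ _ _ _)) => [[i _]|[i xi]].
    by rewrite (abI i).2 in_int_range; exists i.
  by exists i; rewrite ?mem_index_enum // (abI i).2 in_int_range.
have bI : injective b.
  move=> i j bij; have [//|/eqP /sep] := eqVneq i j.
  by have := (abI i).1; have := (abI j).1; lia.
have -> : right_ends F = [fset b i | i in 'I_k].
  apply/fsetP => x; rewrite in_right_ends; apply/andP/imfsetP => /=.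
    move=> [/inF [i xi] /inF xS]; exists i => //.
    have [//|xb] := eqVneq x (b i).
    by case: xS; exists i; lia.
  move=> [i _ ->]; have abi := (abI i).1; split.
    by apply/inF; exists i; rewrite abi leqnn.
  apply/inF => -[j bj]; have [ij|/eqP /sep] := eqVneq i j.
    by rewrite ij in bj; lia.
  by lia.
by rewrite card_imfset //= -cardE card_ord.
Qed.

(** The run that ends at [e] starts at the least [a] such that all of
[{a, ..., e}] lies in [F]. Two such runs are separated: if [e < f] are right
ends, the run of [f] cannot reach down to [e + 1], which is not in [F]. *)
Lemma union_of_right_ends F : union_of_intervals #|` right_ends F| F.
Proof.
have start e : e \in F ->
    exists a, [/\ a <= e, {subset int_range a e <= F}
      & forall x, x <= e -> {subset int_range x e <= F} -> a <= x].
  move=> eF; pose P x := (x <= e) && all (mem F) (index_iota x e.+1).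
  have PP x : P x <-> x <= e /\ {subset int_range x e <= F}.
    split=> [/andP [xe /allP xF]|[xe xF]].
      split=> // y; rewrite in_int_range => yI; apply: xF.
      by rewrite mem_index_iota ltnS.
    apply/andP; split=> //; apply/allP => y; rewrite mem_index_iota ltnS => yI.
    by apply: xF; rewrite in_int_range.
  have exP : exists x, P x.
    exists e; apply/PP; split=> // y; rewrite in_int_range -eqn_leq.
    by move=> /eqP <-.
  have [a /PP [ae aF] amin] := ex_minnP exP.
  by exists a; split=> // x xe xF; apply: amin; apply/PP.
set R := right_ends F.
have RF (e : R) : val e \in F /\ (val e).+1 \notin F.
  by have := valP e; rewrite in_right_ends => /andP.
have [st stP] := choice (fun e : R => start _ (RF e).1).
have {}stP e : [/\ st e <= val e, {subset int_range (st e) (val e) <= F}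
    & forall x, x <= val e -> {subset int_range x (val e) <= F} -> st e <= x].
  exact: stP.
have cR : #|` R| = #|{: R}| by rewrite -cardfE.
rewrite cR; pose I (i : 'I_#|{: R}|) :=
  int_range (st (enum_val i)) (val (enum_val i)).
exists I; split.
- move=> i; exists (st (enum_val i)), (val (enum_val i)); split=> //.
  by case: (stP (enum_val i)).
- have sep (e f : R) : val e < val f -> val e + 1 < st f.
    move=> ef; have [ste seF _] := stP e; have [stf sfF _] := stP f.
    have [_ eSF] := RF e; rewrite addn1.
    have eS : val e < st f.
      rewrite ltnNge; apply/negP => fe; case/negP: eSF; apply: sfF.
      by rewrite in_int_range ef ltnW.
    rewrite ltn_neqAle eS andbT; apply: contra eSF => /eqP ->.
    by apply: sfF; rewrite in_int_range leqnn.
  move=> i j ij; rewrite /separated /I.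
  have [[ste _ _] [stf _ _]] := (stP (enum_val i), stP (enum_val j)).
  rewrite !set_max_int_range ?set_min_int_range //.
  have := sep (enum_val i) (enum_val j); have := sep (enum_val j) (enum_val i).
  have [|//|/val_inj /enum_val_inj //] :=
    ltngtP (val (enum_val i)) (val (enum_val j)); auto.
apply/fsetP => x; apply/idP/bigfcupP => [xF|[i _ xI]]; last first.
  by case: (stP (enum_val i)) => _ sF _; apply: sF.
(* The run through [x] ends just before the first gap [x + d] above [x]. *)
have exn : exists d, x + d \notin F.
  exists (set_max F).+1; apply/negP.
  move=> /(fun h => @leq_bigmax_seq _ _ xpredT id _ h isT).
  by rewrite -/(set_max F); lia.
have [d dF dmin] := ex_minnP exn.
have d0 : 0 < d by case: d dF {dmin} => //; rewrite addn0 xF.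
have xe y : x <= y <= (x + d).-1 -> y \in F.
  move=> yI; apply/negPn/negP => yF.
  have := dmin (y - x); rewrite subnKC; last by lia.
  by move=> /(_ yF); lia.
have eR : (x + d).-1 \in R.
  rewrite in_right_ends prednK ?dF ?andbT; last by lia.
  by apply: xe; lia.
exists (enum_rank [` eR]); first by rewrite mem_index_enum.
rewrite /I enum_rankK in_int_range /=; case: (stP [` eR]) => _ _ smin.
apply/andP; split; last by lia.
apply: smin => /=; first by lia.
by move=> y; rewrite in_int_range => /xe.
Qed.

(** * Removing the largest element *)

(** The condition on the elements of [F] is the Schreier inequality, except that
it lets the empty set in. *)
Definition runs (k n : nat) : {fset {fset nat}} :=
  [fset F in fpowerset (int_range 1 n) |
     (#|` right_ends F| == k) && all (leq #|` F|) F].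

Definition runs_with_max (k n : nat) : {fset {fset nat}} :=
  [fset F in runs k n | n \in F].

Lemma in_runs_with_max k n F :
  (F \in runs_with_max k n) = (F \in runs k n) && (n \in F).
Proof. by rewrite /runs_with_max in_fset inE. Qed.

Lemma in_runs k n F :
  (F \in runs k n) = [&& F `<=` int_range 1 n, #|` right_ends F| == k
                     & all (leq #|` F|) F].
Proof. by rewrite -fpowersetE; apply: in_fset. Qed.

Lemma in_Jkn k n F :
  (F \in Jkn k n) =
    (F `<=` int_range 1 n) && `[< schreier F /\ union_of_intervals k F >].
Proof. by rewrite -fpowersetE; apply: in_fset. Qed.

Lemma runsP k n F :
  reflect [/\ forall x, x \in F -> 1 <= x <= n, #|` right_ends F| = k
            & forall x, x \in F -> #|` F| <= x]
          (F \in runs k n).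
Proof.
rewrite in_runs; apply: (iffP and3P) => -[Fn /eqP Fk FS]; split=> //.
- by move=> x /(fsubsetP Fn); rewrite in_int_range.
- exact/allP.
- by apply/fsubsetP => x /Fn; rewrite in_int_range.
- exact/allP.
Qed.

Lemma Jkn_runs k n : 0 < k -> Jkn k n = runs k n.
Proof.
move=> k0; apply/fsetP => F.
rewrite in_Jkn in_runs; congr andb.
apply/asboolP/andP => [[[/eqP F0 FS] /card_right_ends Fk]|[/eqP Fk /allP FS]].
  by split; [exact/eqP|apply/allP/(leq_set_min _ F0)].
have F0 : F != fset0.
  apply/eqP => F0; have : right_ends F = fset0.
    by apply/fsetP=> x; rewrite F0 !inE.
  by move=> R0; move: Fk k0; rewrite R0 cardfs0 => <-.
split; last by rewrite -Fk; apply: union_of_right_ends.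
by split; [exact/eqP|apply/(leq_set_min _ F0)].
Qed.

Lemma card_runs0 n : #|` runs 0 n| = 1.
Proof.
suff -> : runs 0 n = [fset fset0] by rewrite cardfs1.
apply/fsetP => F; rewrite in_fset1; apply/runsP/eqP => [[_ /eqP F0 _]|->].
  have [// | /fset0Pn [x xF]] := eqVneq F fset0.
  have := union_of_right_ends F; rewrite (eqP F0) => -[I [_ _ FE]].
  by move: xF; rewrite FE => /bigfcupP [[]].
by split=> [x|| x]; rewrite ?inE //; apply/eqP; rewrite cardfs_eq0;
   apply/eqP/fsetP => x; rewrite !inE.
Qed.

Lemma card_runsS k n :
  #|` runs k n.+1| = #|` runs k n| + #|` runs_with_max k n.+1|.
Proof.
have -> : runs k n.+1 = runs k n `|` runs_with_max k n.+1.
  apply/fsetP => F; rewrite in_fsetU; apply/idP/orP.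
    move=> FA; have [nF|nF] := boolP (n.+1 \in F).
      by right; rewrite in_runs_with_max FA nF.
    left; have [Fn Fk FS] := runsP _ _ _ FA; apply/runsP.
    split=> // x xF.
    have /andP [-> xn] := Fn x xF; rewrite -ltnS ltn_neqAle xn andbT.
    by apply: contra nF => /eqP <-.
  move=> [/runsP [Fn Fk FS]|]; last by rewrite in_runs_with_max => /andP [].
  by apply/runsP; split=> // x /Fn; lia.
rewrite cardfsU; suff -> : runs k n `&` runs_with_max k n.+1 = fset0.
  by rewrite cardfs0 subn0.
apply/fsetP => F; rewrite in_fsetI in_fset0; apply/negP => /andP [/runsP [Fn _ _]].
by rewrite in_runs_with_max => /andP [_ /Fn]; rewrite ltnn andbF.
Qed.

(** Inverse to removing the maximum [n + 2] and translating by [-1]. *)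
Definition extend (n : nat) (F : {fset nat}) : {fset nat} :=
  n.+2 |` [fset x.+1 | x in F].

Lemma in_succ (F : {fset nat}) x : (x.+1 \in [fset x.+1 | x in F]) = (x \in F).
Proof. by apply/imfsetP/idP => [[y yF [->]]|xF] //; exists x. Qed.

Lemma in_extendS n F x : (x.+1 \in extend n F) = (x == n.+1) || (x \in F).
Proof. by rewrite /extend in_fset1U in_succ eqSS. Qed.

Lemma in_extend0 n F : (0 \in extend n F) = false.
Proof. by rewrite /extend in_fset1U /=; apply/imfsetP => -[]. Qed.

Lemma card_extend n (F : {fset nat}) : (forall x, x \in F -> 1 <= x <= n) ->
  #|` extend n F| = #|` F|.+1.
Proof.
move=> Fn; rewrite cardfsU1 in_succ card_imfset /=; last exact: succn_inj.
by case: (boolP (n.+1 \in F)) => // /Fn; lia.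
Qed.

(** Translation carries right ends to right ends. The new element [n + 2] is a
right end, and it absorbs the run that ended at [n], if there was one. *)
Lemma card_right_ends_extend n (F : {fset nat}) :
  (forall x, x \in F -> 1 <= x <= n) ->
  #|` right_ends (extend n F)| = #|` right_ends F| + (n \notin F).
Proof.
move=> Fn.
have nF x : n < x -> x \in F = false by move=> nx; apply/negP => /Fn; lia.
have -> : right_ends (extend n F) = extend n (right_ends F `\ n).
  apply/fsetP => -[|x]; first by rewrite in_right_ends !in_extend0.
  rewrite in_right_ends !in_extendS eqSS in_fsetD1 in_right_ends negb_or.
  have [->|xn] := eqVneq x n.+1; first by rewrite !nF ?gtn_eqF.
  by rewrite /= andbCA.
rewrite card_extend; last first.
  by move=> x; rewrite in_fsetD1 in_right_ends => /and3P [_ /Fn].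
have /= -> := cardfsD1 n (right_ends F).
rewrite in_right_ends (nF n.+1) // andbT.
by case: (n \in F); lia.
Qed.

(** The two terms on the right count the sets [extend n F] according to whether
[n] lies in [F]. For [n = 0] the truncated [n.-1] is harmless: the empty set is
then the only [F], and it is counted by the second term. *)
Lemma card_runs_with_maxSS k n :
  #|` runs_with_max k.+1 n.+2| = #|` runs_with_max k.+1 n| + #|` runs k n.-1|.
Proof.
have rng F k' m :
    m <= n -> F \in runs k' m -> forall x, x \in F -> 1 <= x <= n.
  by move=> mn /runsP [Fm _ _] x /Fm; lia.
have rngU F : F \in runs_with_max k.+1 n `|` runs k n.-1 ->
    forall x, x \in F -> 1 <= x <= n.
  rewrite in_fsetU => /orP [|]; last by apply: rng; lia.
  by rewrite in_runs_with_max => /andP [/rng FA _]; apply: FA.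
have nA F : F \in runs k n.-1 -> n \notin F.
  by move=> /runsP [Fn _ _]; apply/negP => /Fn; lia.
have -> : runs_with_max k.+1 n.+2 =
    [fset extend n F | F in runs_with_max k.+1 n `|` runs k n.-1].
  apply/fsetP => G; apply/idP/imfsetP => /=.
    rewrite in_runs_with_max => /andP [/runsP [Gn Gk GS] nG].
    pose F : {fset nat} := [fset x in int_range 1 n | x.+1 \in G].
    have inF x : (x \in F) = (1 <= x <= n) && (x.+1 \in G).
      by rewrite -in_int_range; apply: in_fset.
    have Fn x : x \in F -> 1 <= x <= n by rewrite inF; case/andP.
    have GE : G = extend n F.
      apply/fsetP => -[|x]; first by rewrite in_extend0; apply/negP => /Gn.
      rewrite in_extendS; have [-> //|xn /=] := eqVneq x n.+1.
      rewrite inF; case: (boolP (x.+1 \in G)) => xG; rewrite ?andbF // andbT.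
      (* The case [x = 0]: [1] is not in [G], since the Schreier inequality
         would make [G] a singleton, and [n + 2] is another element of it. *)
      have := Gn _ xG; have : 1 < #|` G|.
        rewrite (cardfsD1 n.+2) nG (cardfsD1 x.+1) !inE xG andbT eqSS xn.
        by lia.
      by have := GS _ xG; lia.
    exists F => //; move: Gk GS.
    rewrite GE card_right_ends_extend // card_extend // => Gk GS.
    have FS x : x \in F -> #|` F| <= x.
      by move=> xF; rewrite -ltnS; apply: GS; rewrite in_extendS xF orbT.
    rewrite in_fsetU; case: (boolP (n \in F)) Gk => nF Gk; apply/orP.
      left; rewrite in_runs_with_max nF andbT; apply/runsP; split=> //.
      by rewrite addn0 in Gk.
    right; apply/runsP; split=> //; last by move: Gk; rewrite addn1 => -[].
    move=> x xF; have /andP [x0 xn] := Fn x xF; rewrite x0 /=.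
    suff : x != n by lia.
    by apply: contraNneq nF => <-.
  move=> [F FU ->]; have Fn := rngU F FU.
  rewrite in_runs_with_max in_extendS eqxx andbT; apply/runsP; split.
  - move=> [|x]; rewrite ?in_extend0 // in_extendS.
    by move=> /orP [/eqP ->|/Fn]; lia.
  - rewrite card_right_ends_extend //; move: FU; rewrite in_fsetU => /orP [|FA].
      by rewrite in_runs_with_max => /andP [/runsP [_ -> _] ->]; rewrite addn0.
    by rewrite nA //; case/runsP: FA => _ -> _; rewrite addn1.
  have FS x : x \in F -> #|` F| <= x.
    move: x; move: FU; rewrite in_fsetU => /orP [|/runsP [] //].
    by rewrite in_runs_with_max => /andP [/runsP []].
  have cF : #|` F| <= n.
    have [->|/fset0Pn [x xF]] := eqVneq F fset0; first by rewrite cardfs0.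
    by apply: leq_trans (FS x xF) _; case/andP: (Fn x xF).
  move=> [|x]; rewrite ?in_extend0 // in_extendS card_extend // ltnS.
  by move=> /orP [/eqP ->|/FS //]; lia.
rewrite card_in_imfset /=; last first.
  move=> F G /rngU Fn /rngU Gn /fsetP FG; apply/fsetP => x.
  have := FG x.+1; rewrite !in_extendS; have [->|//] := eqVneq x n.+1.
  by move=> _; apply/idP/idP => [/Fn|/Gn]; lia.
rewrite cardfsU; suff -> : runs_with_max k.+1 n `&` runs k n.-1 = fset0.
  by rewrite cardfs0 subn0.
apply/fsetP => F; rewrite in_fsetI in_fset0; apply/negP => /andP [].
by rewrite in_runs_with_max => /andP [_ nF] /nA; rewrite nF.
Qed.

Lemma card_runs_n0 k : #|` runs k 0| = (k == 0).
Proof.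
case: k => [|k]; first by rewrite card_runs0.
apply/eqP; rewrite cardfs_eq0; apply/eqP/fsetP => F; rewrite in_fset0.
apply/negP => FA; have [Fn Fk _] := runsP _ _ _ FA.
have /eqP : right_ends F = fset0.
  apply/fsetP => x; rewrite in_fset0 in_right_ends.
  by apply/negP => /andP [/Fn]; lia.
by rewrite -cardfs_eq0 Fk.
Qed.

Lemma card_runs_with_max_n0 k : #|` runs_with_max k 0| = 0.
Proof.
apply/eqP; rewrite cardfs_eq0; apply/eqP/fsetP => F; rewrite in_fset0.
by apply/negP; rewrite in_runs_with_max => /andP [/runsP [Fn _ _] /Fn].
Qed.

Lemma card_runs_with_max_n1 k : #|` runs_with_max k.+1 1| = (k == 0).
Proof.
have F1 F k' : F \in runs_with_max k' 1 -> F = [fset 1].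
  rewrite in_runs_with_max => /andP [/runsP [Fn _ _] F1].
  apply/fsetP => x; rewrite in_fset1.
  by apply/idP/eqP => [/Fn|->] //; lia.
have r1 : right_ends [fset 1] = [fset 1].
  apply/fsetP => x; rewrite in_right_ends !in_fset1.
  by case: eqVneq => // ->.
case: k => [|k].
  suff -> : runs_with_max 1 1 = [fset [fset 1]] by rewrite cardfs1.
  apply/fsetP => F; rewrite in_fset1; apply/idP/eqP => [/F1 //|->].
  rewrite in_runs_with_max in_fset1 eqxx andbT; apply/runsP.
  split=> [x||x]; rewrite ?r1 ?cardfs1 // in_fset1 => /eqP -> //.
apply/eqP; rewrite cardfs_eq0; apply/eqP/fsetP => F; rewrite in_fset0.
apply/negP => FB; move: (FB); rewrite in_runs_with_max => /andP [/runsP [_ Fk _] _].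
by move: Fk; rewrite (F1 _ _ FB) r1 cardfs1.
Qed.

(** * The recurrence and the initial values *)

(** This is [(E - 1)^2 (E + 1) a_(k+1) = a_k], without subtractions.
It comes from eliminating [b_(k+1) (n + 3)] and [b_(k+1) (n + 1)]. *)
Lemma card_runs_rec k n :
  #|` runs k.+1 n.+3| + #|` runs k.+1 n|
    = #|` runs k.+1 n.+2| + #|` runs k.+1 n.+1| + #|` runs k n|.
Proof.
by rewrite (card_runsS _ n.+2) (card_runsS _ n) card_runs_with_maxSS /=; lia.
Qed.

Lemma card_runs_n1 k : #|` runs k.+1 1| = (k == 0).
Proof. by rewrite card_runsS card_runs_n0 card_runs_with_max_n1. Qed.

Lemma card_runs_n2 k : #|` runs k.+1 2| = (k == 0) * 2.
Proof.
rewrite card_runsS card_runs_n1 card_runs_with_maxSS.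
by rewrite card_runs_with_max_n0 card_runs_n0; lia.
Qed.

Lemma card_runs_small k n : n <= 3 * k -> #|` runs k.+1 n| = 0.
Proof.
elim: k n => [|k IH] n; first by case: n => // _; rewrite card_runs_n0.
elim/ltn_ind: n => -[|[|[|n]]] IHn nk.
- by rewrite card_runs_n0.
- by rewrite card_runs_n1.
- by rewrite card_runs_n2.
have := card_runs_rec k.+1 n.
rewrite (IH n) ?(IHn n) ?(IHn n.+1) ?(IHn n.+2); lia.
Qed.

(** At [n = 3 (k + 1) + 1 + i], for [0 <= i <= 3], the recurrence combines
the value for one run less at [n - 3], which is the [i]-th one of the induction
hypothesis, with earlier values for the present number of runs, which vanish
below [3 (k + 1) + 1]. *)
Lemma card_runs_init k :
  [/\ #|` runs k.+1 (3 * k).+1| = 1,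
      #|` runs k.+1 (3 * k).+2| = k + 2,
      #|` runs k.+1 (3 * k).+3| = 'C(k + 2, 2) + 2 * k + 3
    & #|` runs k.+1 (3 * k).+4|
        = 'C(k + 2, 3) + 2 * 'C(k + 2, 2) + (k + 2) ^ 2].
Proof.
elim: k => [|k [v0 v1 v2 v3]].
  have v1 := card_runs_n1 0; have v2 := card_runs_n2 0.
  have v3 := card_runs_rec 0 0; have v4 := card_runs_rec 0 1.
  have v0 := card_runs_n0 1; rewrite !card_runs0 in v3 v4.
  rewrite muln0 add0n binn.
  rewrite v0 v1 v2 /= addn0 in v3; rewrite v1 v2 v3 /= in v4.
  by rewrite v1 v2 v3; split=> //; apply: (@addIn 1); rewrite v4.
have z m : m <= (3 * k).+3 -> #|` runs k.+2 m| = 0.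
  by move=> mk; apply: card_runs_small; lia.
have E : 3 * k.+1 = (3 * k).+3 by lia.
have r1 := card_runs_rec k.+1 (3 * k).+1.
have r2 := card_runs_rec k.+1 (3 * k).+2.
have r3 := card_runs_rec k.+1 (3 * k).+3.
have r4 := card_runs_rec k.+1 (3 * k).+4.
have z1 := z _ (leqW (leqnSn (3 * k).+1)).
have z2 := z _ (leqnSn (3 * k).+2).
have z3 := z _ (leqnn (3 * k).+3).
have c2 : 'C(k.+1 + 2, 2) = 'C(k + 2, 2) + (k + 2) by rewrite addSn binS bin1.
have c3 : 'C(k.+1 + 2, 3) = 'C(k + 2, 3) + 'C(k + 2, 2) by rewrite addSn binS.
rewrite E c2 c3 -!mulnn; rewrite -mulnn in v3.
by split; lia.
Qed.

Local Open Scope ring_scope.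

(** * Polynomials acting on sequences by shifts *)

Section ShiftAction.

Variable R : nzRingType.
Implicit Types (p q : {poly R}) (a : nat -> R).

(** [p] evaluated at the shift operator [E], applied to [a]. *)
Definition shift_act p a (n : nat) : R := \sum_(i < size p) p`_i * a (n + i)%N.

(** Letting the range of summation be any bound on the size of [p] avoids
computing the size of sums and products. *)
Lemma shift_actE p a n N : (size p <= N)%N ->
  shift_act p a n = \sum_(i < N) p`_i * a (n + i)%N.
Proof.
move=> pN; rewrite /shift_act (big_ord_widen N (fun i => p`_i * a (n + i)%N)) //.
rewrite big_mkcond /=; apply: eq_bigr => i _; case: ltnP => // pi.
by rewrite nth_default // mul0r.
Qed.

Lemma shift_actD p q a n :
  shift_act (p + q) a n = shift_act p a n + shift_act q a n.
Proof.
pose N := maxn (size p) (size q).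
rewrite !(@shift_actE _ _ _ N) ?size_polyD ?leq_maxl ?leq_maxr //.
by rewrite -big_split /=; apply: eq_bigr => i _; rewrite coefD mulrDl.
Qed.

Lemma shift_actC c a n : shift_act c%:P a n = c * a n.
Proof.
rewrite (@shift_actE _ _ _ 1) ?size_polyC ?leq_b1 // big_ord1 coefC /=.
by rewrite addn0.
Qed.

Lemma shift_actCM c p a n : shift_act (c%:P * p) a n = c * shift_act p a n.
Proof.
rewrite mul_polyC (@shift_actE (c *: p) _ _ (size p)) ?size_scale_leq //.
by rewrite mulr_sumr; apply: eq_bigr => i _; rewrite coefZ mulrA.
Qed.

Lemma shift_actMX p a n : shift_act (p * 'X) a n = shift_act p a n.+1.
Proof.
rewrite (@shift_actE _ _ _ (size p).+1); last first.
  by apply: leq_trans (size_polyMleq _ _) _; rewrite size_polyX addn2.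
rewrite big_ord_recl coefMX mul0r add0r.
by apply: eq_bigr => i _; rewrite coefMX /= addSnnS.
Qed.

Lemma eq_shift_act p a b : a =1 b -> shift_act p a =1 shift_act p b.
Proof. by move=> ab n; apply: eq_bigr => i _; rewrite ab. Qed.

(** Products of polynomials act by composition, so that the factors of a
characteristic polynomial can be applied one after the other. *)
Lemma shift_actM p q a : shift_act (p * q) a =1 shift_act p (shift_act q a).
Proof.
elim/poly_ind: p => [|p c IH] n.
  by rewrite mul0r /shift_act size_poly0 !big_ord0.
rewrite mulrDl -mulrA -commr_polyX mulrA !shift_actD !shift_actMX IH.
by rewrite shift_actCM shift_actC.
Qed.

End ShiftAction.

Lemma shift_act_rec (R : comNzRingType) (a : nat -> R) n :
  shift_act (('X - 1) ^+ 2 * ('X + 1)) a n = a n.+3 - a n.+2 - a n.+1 + a n.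
Proof.
have -> : ('X - 1) ^+ 2 * ('X + 1) =
  ((1%:P * 'X + (-1)%:P) * 'X + (-1)%:P) * 'X + 1%:P :> {poly R}.
  by rewrite polyCN; ring.
rewrite !(shift_actD, shift_actMX, shift_actC); ring.
Qed.

(** Each factor [(E - 1)^2 (E + 1)] lowers the number of runs by one, and the
last [E - 1] kills the constant sequence [a_0]. *)
Lemma shift_act_char (R : comNzRingType) k n :
  shift_act (('X - 1) ^+ (2 * k + 1) * ('X + 1) ^+ k)
    (fun m => #|` runs k m|%:R : R) n = 0.
Proof.
elim: k n => [|k IH] n.
  rewrite muln0 expr1 expr0 mulr1.
  have -> : 'X - 1 = 1%:P * 'X + (-1)%:P :> {poly R} by rewrite polyCN mul1r.
  by rewrite shift_actD shift_actMX !shift_actC !card_runs0; ring.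
have -> : ('X - 1) ^+ (2 * k.+1 + 1) * ('X + 1) ^+ k.+1 =
    (('X - 1) ^+ (2 * k + 1) * ('X + 1) ^+ k) * (('X - 1) ^+ 2 * ('X + 1))
    :> {poly R}.
  by rewrite mulrACA -exprD -exprSr; congr (_ ^+ _ * _); lia.
rewrite shift_actM -[RHS](IH n); apply: eq_shift_act => m.
rewrite shift_act_rec addrAC [_ - _ + _]addrAC.
have /(congr1 (fun x : nat => x%:R : R)) := card_runs_rec k m.
by rewrite !natrD => ->; ring.
Qed.

Local Close Scope ring_scope.

Theorem theorem1p2 (k : nat) (hk : 1 <= k) :
  [/\ forall n : nat, 1 <= n <= 3 * k - 3 -> #|` Jkn k n| = 0,
      #|` Jkn k (3 * k - 2)| = 1,
      #|` Jkn k (3 * k - 1)| = k + 1,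
      #|` Jkn k (3 * k)| = 'C(k + 1, 2) + 2 * k + 1
    & #|` Jkn k (3 * k + 1)|
        = 'C(k + 1, 3) + 2 * 'C(k + 1, 2) + (k + 1) ^ 2]
  /\ (forall R : realType,
        satisfies (fun n : nat => (#|` Jkn k n|)%:R%R : R)
          (('X - 1) ^+ (2 * k + 1) * ('X + 1) ^+ k)%R).
Proof.
split.
  case: k hk => // k _.
  have [v0 v1 v2 v3] := card_runs_init k.
  have -> : k.+1 + 1 = k + 2 by lia.
  rewrite !Jkn_runs //; split=> [n nk||||].
  - by rewrite Jkn_runs // card_runs_small //; lia.
  - by rewrite -v0; congr #|` runs _ _|; lia.
  - by rewrite -v1; congr #|` runs _ _|; lia.
  - rewrite (_ : 3 * k.+1 = (3 * k).+3) ?v2; lia.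
  - by rewrite -v3; congr #|` runs _ _|; lia.
move=> R r n _.
have -> := esym (shift_actE (fun m => #|` Jkn k m|%:R%R) (n - r) (leqSpred _)).
rewrite (eq_shift_act _ (b := fun m => #|` runs k m|%:R%R)).
  exact: shift_act_char.
by move=> m; rewrite Jkn_runs.
Qed.
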